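(* Let $f\colon X\to\overline{\mathbb{R}}$ and $g\colon W\to\overline{\mathbb{R}}$ be proper functions, $x_0\in X$ and $(x_0^*,u_0^*,\alpha_0)\in W$. Then: (i) $\partial_c f(x_0)\subseteq W$ and $\partial_{c'}g(x_0^*,u_0^*,\alpha_0)\subseteq X$ are e-convex sets. (ii) If $\partial_c f(x_0)\neq\emptyset$, then $(\operatorname{e-conv}f)(x_0)=f(x_0)$ and, moreover, $\partial_c(\operatorname{e-conv}f)(x_0)=\partial_c f(x_0)$. (iii) If $\partial_{c'}g(x_0^*,u_0^*,\alpha_0)\neq\emptyset$, then $(\operatorname{e'-conv}g)(x_0^*,u_0^*,\alpha_0)=g(x_0^*,u_0^*,\alpha_0)$ and, moreover, $\partial_{c'}(\operatorname{e'-conv}g)(x_0^*,u_0^*,\alpha_0)=\partial_{c'}g(x_0^*,u_0^*,\alpha_0)$. (iv) If $x_0\in\partial_{c'}g(x_0^*,u_0^*,\alpha_0)$ and $\operatorname{dom}g\subseteq\{(x^*,u^*,\alpha)\in W:\langle x_0,u^*\rangle-\alpha<0\}$, then $(x_0,0,0)\in\partial g(x_0^*,u_0^*,\alpha_0)$.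
   Context: $X$ is a nontrivial separated (Hausdorff) real locally convex space with continuous dual $X^*$; $X$ carries the topology $\sigma(X,X^* )$ and $X^*$ the topology $\sigma(X^*,X)$; $\langle x,x^*\rangle$ is the value of $x^*\in X^*$ at $x\in X$. $\overline{\mathbb{R}}=\mathbb{R}\cup\{\pm\infty\}$. $W:=X^*\times X^*\times\mathbb{R}$ with the product topology (its dual is identified with $X\times X\times\mathbb{R}$ via $\langle x,x^*\rangle+\langle u,u^*\rangle+\alpha\beta$). For an extended-real-valued function $h$, $\operatorname{dom}h=\{h<+\infty\}$; $h$ is proper if it never takes the value $-\infty$ and $\operatorname{dom}h\neq\emptyset$. A subset $C$ of a locally convex space $Y$ is e-convex if for every $y_0\notin C$ there is $y^*\in Y^*$ with $\langle y-y_0,y^*\rangle<0$ for all $y\in C$ (equivalently, $C$ is an intersection of a possibly empty family of open half-spaces). A function $h\colon X\to\overline{\mathbb{R}}$ is e-convex if its epigraph $\{(x,r)\in X\times\mathbb{R}:h(x)\le r\}$ is e-convex in $X\times\mathbb{R}$; $\operatorname{e-conv}h$ is the largest e-convex minorant of $h$. Coupling functions: $c(x,(x^*,u^*,\alpha))=c'((x^*,u^*,\alpha),x):=\langle x,x^*\rangle$ if $\langle x,u^*\rangle<\alpha$, and $+\infty$ otherwise. A function $h\colon W\to\overline{\mathbb{R}}$ is e$'$-convex if it is a pointwise supremum of a set of functions of the form $w\in W\mapsto c'(w,x)-\beta$ with $x\in X$, $\beta\in\mathbb{R}$; $\operatorname{e'-conv}h$ denotes the largest e$'$-convex minorant of $h$.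 $c$-subdifferential: for $f\colon X\to\overline{\mathbb{R}}$ proper with $f(x_0)\in\mathbb{R}$, $\partial_c f(x_0)$ is the set of $w=(x^*,u^*,\alpha)\in W$ such that $\langle x_0,u^*\rangle<\alpha$ and $f(x)-f(x_0)\ge c(x,w)-c(x_0,w)$ for all $x\in X$; if $f(x_0)\notin\mathbb{R}$, $\partial_c f(x_0)=\emptyset$. $c'$-subdifferential: for $g\colon W\to\overline{\mathbb{R}}$ proper and $w_0=(x_0^*,u_0^*,\alpha_0)$ with $g(w_0)\in\mathbb{R}$, $\partial_{c'}g(w_0)$ is the set of $x\in X$ such that $\langle x,u_0^*\rangle<\alpha_0$ and $g(w)-g(w_0)\ge c'(w,x)-c'(w_0,x)$ for all $w\in W$; if $g(w_0)\notin\mathbb{R}$, $\partial_{c'}g(w_0)=\emptyset$. $\partial g(x_0^*,u_0^*,\alpha_0)$ is the classical (Fenchel) subdifferential: when $g(x_0^*,u_0^*,\alpha_0)\in\mathbb{R}$, the set of $(y,v,\gamma)\in X\times X\times\mathbb{R}$ with $g(x^*,u^*,\alpha)\ge g(x_0^*,u_0^*,\alpha_0)+\langle y,x^*-x_0^*\rangle+\langle v,u^*-u_0^*\rangle+\gamma(\alpha-\alpha_0)$ for all $(x^*,u^*,\alpha)\in W$. *)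

(* Defs.v *)
From HB Require Import structures.
From mathcomp Require Import all_boot all_order all_algebra.
From mathcomp Require Import all_classical all_reals all_analysis.

Set Implicit Arguments.
Unset Strict Implicit.
Unset Printing Implicit Defensive.

Import Order.TTheory GRing.Theory Num.Theory.
Import numFieldNormedType.Exports.

Local Open Scope classical_set_scope.
Local Open Scope ring_scope.

Section InducedTopology.
Context {R : realType} {E : lmodType R} {I : Type}.

(* E with the coarsest topology making every functional phi i continuous *)
Definition induced_by (phi : I -> {linear E -> R^o}) : Type := E.

Variable phi : I -> {linear E -> R^o}.
Let T := induced_by phi.

HB.instance Definition _ := GRing.Lmodule.copy T E.
HB.instance Definition _ := Topological.copy T
  (sup_topology (fun i => Topological.class
     (initial_topology (phi i : E -> R^o)))).

Lemma induced_by_cvgP (F : set_system T) (t : T) : Filter F ->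
  F --> t <-> forall i, (phi i x : R^o) @[x --> F] --> (phi i t : R^o).
Proof.
move=> FF; apply: (iff_trans (cvg_sup _ _ _)); split=> Ft i.
  move=> A nA; apply: (Ft i).
  exact: (@initial_continuous _ _ (phi i : E -> R^o) (t : E)).
move=> A [_ [[B Bop <-] Bt] BA]; apply: filterS BA _.
by apply: (Ft i); exact: open_nbhs_nbhs.
Qed.

Lemma induced_by_continuous i : continuous (phi i : T -> R^o).
Proof. by move=> t; apply: (proj1 (induced_by_cvgP _ (nbhs_filter t))). Qed.

Let phiD i (x y : T) : phi i (x + y) = phi i x + phi i y :> R^o.
Proof. exact: linearD. Qed.

Let phiZ i k (x : T) : phi i (k *: x) = k *: (phi i x : R^o).
Proof. exact: linearZ. Qed.

Let add_cont : continuous (fun x : T * T => x.1 + x.2).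
Proof.
move=> [x y]; apply/induced_by_cvgP => i.
have phi1 : (phi i z.1 : R^o) @[z --> ((x, y) : T * T)] --> (phi i x : R^o).
  by apply: cvg_comp; [exact: cvg_fst|exact: induced_by_continuous].
have phi2 : (phi i z.2 : R^o) @[z --> ((x, y) : T * T)] --> (phi i y : R^o).
  by apply: cvg_comp; [exact: cvg_snd|exact: induced_by_continuous].
have phiE : (fun z : T * T => phi i (z.1 + z.2) : R^o) =
    (fun z => (phi i z.1 : R^o) + phi i z.2).
  by apply/funext => z; exact: phiD.
have phi12 : ((phi i z.1 : R^o) + phi i z.2) @[z --> ((x, y) : T * T)] -->
  phi i (x + y) by rewrite phiD; exact: cvgD.
by rewrite -phiE in phi12.
Qed.

Let scale_cont : continuous (fun z : R^o * T => z.1 *: z.2).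
Proof.
move=> [k x]; apply/induced_by_cvgP => i.
have phi1 : z.1 @[z --> ((k, x) : R^o * T)] --> k by exact: cvg_fst.
have phi2 : (phi i z.2 : R^o) @[z --> ((k, x) : R^o * T)] --> (phi i x : R^o).
  by apply: cvg_comp; [exact: cvg_snd|exact: induced_by_continuous].
have phiE : (fun z : R^o * T => phi i (z.1 *: z.2) : R^o) =
    (fun z => z.1 *: (phi i z.2 : R^o)).
  by apply/funext => z; exact: phiZ.
have phi12 : (z.1 *: (phi i z.2 : R^o)) @[z --> ((k, x) : R^o * T)] -->
  phi i (k *: x) by rewrite phiZ; exact: cvgZ.
by rewrite -phiE in phi12.
Qed.

Let loc_convex :
  exists2 B : set_system T, (forall b, b \in B -> convex_set b) & basis B.
Proof.
exists [set U : set T | open U /\ convex_set U].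
  by move=> b; rewrite inE => -[].
split; first by move=> U [].
move=> x; apply/induced_by_cvgP.
  apply: filter_from_filter.
    exists setT; split=> //; split; first exact: openT.
    by move=> *; rewrite inE.
  move=> U V [[oU cU] Ux] [[oV cV] Vx]; exists (U `&` V) => //.
  split=> //; split; first exact: openI.
  move=> a b l /[!inE] -[Ua Va] [Ub Vb]; split.
    by apply/set_mem/cU; apply/mem_set.
  by apply/set_mem/cV; apply/mem_set.
have [B convB [openB nbhsB]] := @locally_convex R R^o.
move=> i A /nbhsB[b [Bb bx] bA].
exists (phi i @^-1` b) => /=; last by move=> y /bA.
split=> //; split.
  apply: open_comp; last exact: openB.
  by move=> y _; exact: induced_by_continuous.
move=> u v l /[!inE] /= bu bv.
rewrite /conv/= phiD !phiZ.
by apply/set_mem/(convB b); apply/mem_set.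
Qed.

(* This factory only provides the uniform structure, hence the next three
   instances. *)
HB.instance Definition _ :=
  PreTopologicalLmod_isTvs.Build R T add_cont scale_cont loc_convex.
HB.instance Definition _ :=
  PreTopologicalNmodule_isTopologicalNmodule.Build T add_cont.
HB.instance Definition _ :=
  TopologicalNmodule_isTopologicalLmodule.Build R T scale_cont.
HB.instance Definition _ := Uniform_isTvs.Build R T loc_convex.

End InducedTopology.

Section Dual.
Context {R : realType} {X : tvsType R}.

Definition dual_pred : {pred X -> R^o} :=
  fun f => `[< linear f /\ continuous f >].

Lemma dual_pred_submod : subsemimod_closed dual_pred.
Proof.
split; first split.
- apply/asboolP; split=> [a x y|]; last exact: cst_continuous.
  by rewrite /= scaler0 addr0.
- move=> f g /asboolP[lf cf] /asboolP[lg cg]; apply/asboolP; split=> [a x y|x].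
    change (f (a *: x + y) + g (a *: x + y) = a *: (f x + g x) + (f y + g y)).
    by rewrite lf lg scalerDr addrACA.
  exact: cvgD (cf x) (cg x).
- move=> k f /asboolP[lf cf]; apply/asboolP; split=> [a x y|x].
    change (k *: f (a *: x + y) = a *: (k *: f x) + k *: f y).
    by rewrite lf scalerDr !scalerA mulrC.
  exact: cvgZr (cf x).
Qed.

HB.instance Definition _ :=
  GRing.isSubmodClosed.Build R (X -> R^o) dual_pred dual_pred_submod.

Record dual : Type := Dual {
  dual_fun :> X -> R^o;
  dual_funP : dual_fun \in dual_pred }.

HB.instance Definition _ := [isSub for dual_fun].
HB.instance Definition _ := [Choice of dual by <:].
HB.instance Definition _ := [SubChoice_isSubLmodule of dual by <:].

Lemma dual_linear (xs : dual) : linear xs.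
Proof. by have /asboolP[] := dual_funP xs. Qed.

Lemma dual_continuous (xs : dual) : continuous xs.
Proof. by have /asboolP[] := dual_funP xs. Qed.

HB.instance Definition _ (xs : dual) :=
  GRing.isLinear.Build R X R^o *:%R xs (dual_linear xs).

Definition pairing (x : X) (xs : dual) : R^o := xs x.

Lemma pairing_linear x : linear (pairing x).
Proof. by []. Qed.

HB.instance Definition _ (x : X) :=
  GRing.isLinear.Build R dual R^o *:%R (pairing x) (pairing_linear x).

(* The dual always carries the weak-star topology, i.e. that of pointwise
   convergence on X. *)
HB.instance Definition _ := Tvs.copy dual
  (induced_by (fun x : X => pairing x : {linear dual -> R^o})).

Lemma pairing_continuous (x : X) : continuous (pairing x).
Proof.
exact: (@induced_by_continuous _ _ _
  (fun x : X => pairing x : {linear dual -> R^o})).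
Qed.

End Dual.
Arguments dual {R} X.

(* X with its weak topology, induced by the dual *)
Definition weak {R : realType} (X : tvsType R) : tvsType R :=
  induced_by (fun xs : dual X => xs : {linear X -> R^o}).

Lemma weak_dual_continuous {R : realType} {X : tvsType R} (xs : dual X) :
  continuous (xs : weak X -> R^o).
Proof.
exact: (@induced_by_continuous _ _ _
  (fun xs : dual X => xs : {linear X -> R^o})).
Qed.

Definition W {R : realType} (X : tvsType R) : tvsType R :=
  (dual X * dual X * R^o)%type.

Section ExtendedRealFunctions.
Context {R : realType} {T : Type}.
Implicit Type h : T -> \bar R.

Definition edom h : set T := [set x | (h x < +oo)%E].

Definition eproper h : Prop := (forall x, h x <> -oo%E) /\ edom h !=set0.

Definition epigraph h : set (T * R^o) := [set p | (h p.1 <= p.2%:E)%E].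

End ExtendedRealFunctions.

Definition e_convex {R : realType} {Y : tvsType R} (C : set Y) : Prop :=
  forall y0, ~ C y0 -> exists ys : dual Y, forall y, C y -> ys (y - y0) < 0.

Section EConvexFunctions.
Context {R : realType} {Y : tvsType R}.
Implicit Types h k : Y -> \bar R.

Definition e_convex_fun h : Prop :=
  e_convex (epigraph h : set (Y * R^o)%type).

Definition e_conv h : Y -> \bar R := fun y =>
  ereal_sup [set k y | k in
    [set k | e_convex_fun k /\ forall z, (k z <= h z)%E]].

Lemma e_conv_le h y : (e_conv h y <= h y)%E.
Proof. by apply: ge_ereal_sup => _ [k [_ kh] <-]. Qed.

Lemma e_conv_max h k : e_convex_fun k -> (forall z, (k z <= h z)%E) ->
  forall y, (k y <= e_conv h y)%E.
Proof. by move=> ck kh y; apply: ereal_sup_ubound; exists k. Qed.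

Lemma e_conv_convex h : e_convex_fun (e_conv h).
Proof.
move=> [y r] /= /negP; rewrite -ltNge => /ereal_sup_gt [_ [k [ck kh] <-]] rk.
have [|ys ysP] := ck (y, r); first by apply/negP; rewrite -ltNge.
exists ys => -[z s] /= hz; apply: ysP.
exact: le_trans (e_conv_max ck kh z) hz.
Qed.

End EConvexFunctions.

Section Couplings.
Context {R : realType} {X : tvsType R}.

Definition coupling (x : X) (w : W X) : \bar R :=
  if w.1.2 x < w.2 then (w.1.1 x)%:E else +oo%E.

Definition coupling' (w : W X) (x : X) : \bar R := coupling x w.

(* The index set may be empty: the constant -oo is then obtained. *)
Definition e'_convex_fun (h : W X -> \bar R) : Prop :=
  exists S : set (X * R),
    h = fun w => ereal_sup [set (coupling' w p.1 - p.2%:E)%E | p in S].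

Definition e'_conv (h : W X -> \bar R) : W X -> \bar R := fun w =>
  ereal_sup [set k w | k in
    [set k | e'_convex_fun k /\ forall z, (k z <= h z)%E]].

Lemma e'_conv_le h w : (e'_conv h w <= h w)%E.
Proof. by apply: ge_ereal_sup => _ [k [_ kh] <-]. Qed.

Lemma e'_conv_max h k : e'_convex_fun k -> (forall z, (k z <= h z)%E) ->
  forall w, (k w <= e'_conv h w)%E.
Proof. by move=> ck kh w; apply: ereal_sup_ubound; exists k. Qed.

Lemma e'_conv_convex h : e'_convex_fun (e'_conv h).
Proof.
exists [set p | forall w, (coupling' w p.1 - p.2%:E <= h w)%E].
apply/funext => w; apply/eqP; rewrite eq_le; apply/andP; split.
  apply: ge_ereal_sup => _ [k [[S ->] kh] <-]; apply: ereal_sup_le.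
  move=> _ [p Sp <-]; exists p => //= z; apply: le_trans (kh z).
  by apply: ereal_sup_ubound; exists p.
apply: ge_ereal_sup => _ [p ph <-].
apply: (@e'_conv_max h (fun z => coupling' z p.1 - p.2%:E)%E) => //.
by exists [set p]; apply/funext => z; rewrite image_set1 ereal_sup1.
Qed.

Definition c_subdiff (f : X -> \bar R) (x0 : X) : set (W X) :=
  [set w : W X | [/\ f x0 \is a fin_num, w.1.2 x0 < w.2 &
    forall x, (f x - f x0 >= coupling x w - coupling x0 w)%E]].

Definition c'_subdiff (g : W X -> \bar R) (w0 : W X) : set X :=
  [set x | [/\ g w0 \is a fin_num, w0.1.2 x < w0.2 &
    forall w, (g w - g w0 >= coupling' w x - coupling' w0 x)%E]].

(* (y, v, gamma) acts on W by
   (xs, us, alpha) |-> xs y + us v + gamma * alpha. *)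
Definition subdiff (g : W X -> \bar R) (w0 : W X) : set (X * X * R) :=
  [set p | g w0 \is a fin_num /\
    forall w, (g w >= g w0 + ((w.1.1 - w0.1.1) p.1.1 + (w.1.2 - w0.1.2) p.1.2
                             + p.2 * (w.2 - w0.2))%:E)%E].

End Couplings.

(* Main.v *)
Require Import Defs.
From HB Require Import structures.
From mathcomp Require Import all_boot all_order all_algebra.
From mathcomp Require Import all_classical all_reals all_analysis.

Set Implicit Arguments.
Unset Strict Implicit.
Unset Printing Implicit Defensive.

Import Order.TTheory GRing.Theory Num.Theory.
Import numFieldNormedType.Exports.

Local Open Scope classical_set_scope.
Local Open Scope ring_scope.

(* With c_w := coupling ^~ w, finiteness at the base point turns
   [w \in c_subdiff f x0] into: c_w - b is a minorant of f that is exact at x0.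
   Such minorants are themselves e-convex, hence lie below the e-convex hull,
   which gives (ii), and dually (iii). A minorant inequality only constrains
   the points of the domain, where it is an open half-space condition together
   with a closed one, and closed half-spaces are e-convex; this gives (i). *)

(** * Half-spaces as e-convex sets, and intersections *)

Section EConvexSets.
Context {R : realType} {Y : tvsType R}.

(** Linearity and continuity make [h] an element of the dual, and linearity turns a comparison with
    [h y0] into a sign at [y - y0]. Functionals given by explicit formulas enter through this. *)
Lemma e_convex_separated (C : set Y) (h : Y -> R^o) (y0 : Y) :
    linear h -> continuous h -> (forall y, C y -> h y < h y0) ->
  exists ys : dual Y, forall y, C y -> ys (y - y0) < 0.
Proof.
move=> lh ch hC.
have hP : h \in dual_pred by apply/asboolP.
exists (Dual hP) => y Cy.
by rewrite linearB subr_lt0; exact: hC.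
Qed.

Lemma e_convex0 : e_convex (set0 : set Y).
Proof. by move=> y0 _; exists 0. Qed.

Lemma e_convex_lt (h : Y -> R^o) (a : R) : linear h -> continuous h ->
  e_convex [set y | h y < a].
Proof.
move=> lh ch y0 /negP; rewrite -leNgt => ay0.
by apply: (e_convex_separated lh ch) => y /lt_le_trans; apply.
Qed.

(** The strict gap required by e-convexity sits at the outside point: [a < h y0], so the open
    half-space [h y < h y0] already contains the closed one. *)
Lemma e_convex_le (h : Y -> R^o) (a : R) : linear h -> continuous h ->
  e_convex [set y | h y <= a].
Proof.
move=> lh ch y0 /negP; rewrite -ltNge => ay0.
by apply: (e_convex_separated lh ch) => y /le_lt_trans; apply.
Qed.

Lemma e_convexI (A B : set Y) : e_convex A -> e_convex B -> e_convex (A `&` B).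
Proof.
move=> cA cB y0 /not_andP[/cA|/cB] [ys ysP]; exists ys => y [Ay By];
  exact: ysP.
Qed.

Lemma e_convex_bigcap I (D : set I) (F : I -> set Y) :
  (forall i, D i -> e_convex (F i)) -> e_convex (\bigcap_(i in D) F i).
Proof.
move=> cF y0 /existsNP[i /not_implyP[Di /(cF i Di)[ys ysP]]].
by exists ys => y Fy; apply: ysP; exact: Fy.
Qed.

End EConvexSets.

(** * Linear forms on [W X] and inequalities for the couplings *)

Section Subdifferentials.
Context {R : realType} {X : tvsType R}.
Implicit Types (x : X) (w : W X).

Lemma W_form_linear x v (c : R) :
  linear (fun w : W X => w.1.1 x + w.1.2 v + c * w.2 : R^o).
Proof.
move=> k w z.
have eval y (xs ys : dual X) : (k *: xs + ys) y = k * xs y + ys y.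
  exact: (pairing_linear y).
have -> : (k *: w + z).1.1 = k *: w.1.1 + z.1.1 by [].
have -> : (k *: w + z).1.2 = k *: w.1.2 + z.1.2 by [].
have -> : (k *: w + z).2 = k * w.2 + z.2 by [].
rewrite !eval -[_ *: (_ + _)]/(k * _) !mulrDr (mulrCA c k).
by rewrite (addrACA (k * _) (z.1.1 x)) [LHS]addrACA.
Qed.

(** Evaluation at a fixed point is continuous for the weak-star topology; the form combines such
    evaluations with the coordinate projections. *)
Lemma W_form_continuous x v (c : R) :
  continuous (fun w : W X => w.1.1 x + w.1.2 v + c * w.2 : R^o).
Proof.
move=> w; apply: cvgD; [apply: cvgD|apply: cvgM; first exact: cvg_cst].
- apply: (@cvg_comp _ _ _ (fun w : W X => w.1.1) (pairing x)).
    by apply: cvg_comp; [exact: cvg_fst|exact: cvg_fst].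
  exact: pairing_continuous.
- apply: (@cvg_comp _ _ _ (fun w : W X => w.1.2) (pairing v)).
    by apply: cvg_comp; [exact: cvg_fst|exact: cvg_snd].
  exact: pairing_continuous.
- exact: cvg_snd.
Qed.

(** A coupling equal to [+oo] can only lie below [y = +oo], where the bound is automatic. Any
    smaller [y] forces the open condition, and a real inequality remains. *)
Lemma coupling_leP x w (a : R) (y : \bar R) :
  (coupling x w - a%:E <= y)%E <->
  ((y < +oo)%E -> w.1.2 x < w.2 /\ ((w.1.1 x - a)%:E <= y)%E).
Proof.
rewrite /coupling; case: ifP => _.
  split=> [le_y _|le_y]; first by rewrite EFinB.
  have [/le_y[_]|] := ltP y +oo%E; first by rewrite EFinB.
  by rewrite leye_eq => /eqP->; rewrite leey.
rewrite addye//; split=> [|le_y].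
  by rewrite leye_eq => /eqP->; rewrite ltxx.
by rewrite leNgt; apply/negP => /le_y[].
Qed.

(** Epigraph heights are real, so [coupling_leP] splits the epigraph into an open half-space in [x]
    and a closed one in the pair; elements of the dual stay continuous for the weak topology. *)
Lemma coupling_epigraph_e_convex w (a : R) :
  @e_convex_fun R (weak X) (fun x : X => coupling x w - a%:E)%E.
Proof.
rewrite /e_convex_fun.
suff -> : epigraph (fun x : X => coupling x w - a%:E)%E =
    [set p : weak X * R^o | w.1.2 p.1 < w.2] `&`
    [set p : weak X * R^o | w.1.1 p.1 - p.2 <= a].
  apply: e_convexI.
    apply: (@e_convex_lt _ _ (fun p : weak X * R^o => w.1.2 p.1)).
      by move=> k p q; exact: (dual_linear w.1.2).
    move=> p; apply: (@cvg_comp _ _ _ fst w.1.2); first exact: cvg_fst.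
    exact: weak_dual_continuous.
  apply: (@e_convex_le _ _ (fun p : weak X * R^o => w.1.1 p.1 - p.2 : R^o)).
    move=> k p q; rewrite /= (dual_linear w.1.1).
    by rewrite scalerBr opprD addrACA.
  move=> p; apply: cvgB; last exact: cvg_snd.
  apply: (@cvg_comp _ _ _ fst w.1.1); first exact: cvg_fst.
  exact: weak_dual_continuous.
apply/seteqP; split=> -[x r] /=.
  move/coupling_leP => /(_ (ltry _))[xw]; rewrite lee_fin => le_r.
  by split=> //; rewrite lerBlDr addrC -lerBlDr.
move=> [xw le_a]; apply/coupling_leP => _; split=> //.
by rewrite lee_fin lerBlDr addrC -lerBlDr.
Qed.

(** Both [coupling x w] and [r] are finite here, so they can be moved across the inequality. This
    puts both subdifferentials in minorant form. *)
Lemma leeB_coupling x w (c d r : \bar R) :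
    r \is a fin_num -> w.1.2 x < w.2 ->
  (c - coupling x w <= d - r)%E = (c - (w.1.1 x - fine r)%:E <= d)%E.
Proof.
move=> fin_r xw; rewrite /coupling xw -[in LHS](fineK fin_r).
by rewrite leeBrDr// EFinB oppeB// addeA.
Qed.

Lemma c_subdiffP (f : X -> \bar R) x0 w : c_subdiff f x0 w <->
  [/\ f x0 \is a fin_num, w.1.2 x0 < w.2 &
    forall x, (coupling x w - (w.1.1 x0 - fine (f x0))%:E <= f x)%E].
Proof.
by split=> -[f0 xw le_f]; split=> // x; move: (le_f x); rewrite leeB_coupling.
Qed.

Lemma c'_subdiffP (g : W X -> \bar R) w0 x : c'_subdiff g w0 x <->
  [/\ g w0 \is a fin_num, w0.1.2 x < w0.2 &
    forall w, (coupling' w x - (w0.1.1 x - fine (g w0))%:E <= g w)%E].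
Proof.
by split=> -[g0 xw le_g]; split=> // w; move: (le_g w); rewrite leeB_coupling.
Qed.

(** * The subdifferentials are e-convex *)

Lemma c_subdiff_e_convex (f : X -> \bar R) x0 :
  (forall x, f x <> -oo%E) -> e_convex (c_subdiff f x0).
Proof.
move=> fNy; have [f0|f0] := boolP (f x0 \is a fin_num); last first.
  suff -> : c_subdiff f x0 = set0 by exact: e_convex0.
  by rewrite -subset0 => w [fin_f0]; rewrite fin_f0 in f0.
have lt_conv x : e_convex [set w : W X | w.1.2 x < w.2].
  (* The condition is homogeneous in [w]: it is the form with coefficients [(0, x, -1)] and bound
     0. *)
  suff -> : [set w : W X | w.1.2 x < w.2] =
      [set w : W X | w.1.1 0 + w.1.2 x + (-1) * w.2 < 0].
    by apply: e_convex_lt; [exact: W_form_linear|exact: W_form_continuous].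
  by apply/seteqP; split=> w /=; rewrite linear0 add0r mulN1r subr_lt0.
have le_conv x (r : R) : e_convex [set w : W X | w.1.1 x - w.1.1 x0 <= r].
  suff -> : [set w : W X | w.1.1 x - w.1.1 x0 <= r] =
      [set w : W X | w.1.1 (x - x0) + w.1.2 0 + 0 * w.2 <= r].
    by apply: e_convex_le; [exact: W_form_linear|exact: W_form_continuous].
  by apply/seteqP; split=> w /=; rewrite linear0 mul0r !addr0 linearB.
(* Each point of the domain contributes one open and one closed half-space of [W X]. *)
suff -> : c_subdiff f x0 = [set w : W X | w.1.2 x0 < w.2] `&`
    \bigcap_(x in edom f) ([set w : W X | w.1.2 x < w.2] `&`
      [set w : W X | w.1.1 x - w.1.1 x0 <= fine (f x) - fine (f x0)]).
  apply: e_convexI => //; apply: e_convex_bigcap => x _.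
  exact: e_convexI.
(* As [f] avoids [-oo], it is finite on its domain, so [fine] loses nothing. *)
have leE x w : edom f x ->
    ((w.1.1 x - (w.1.1 x0 - fine (f x0)))%:E <= f x)%E =
    (w.1.1 x - w.1.1 x0 <= fine (f x) - fine (f x0)).
  move=> fx; have fin_fx : f x \is a fin_num.
    by rewrite fin_numE -ltey; apply/andP; split=> //; apply/eqP/fNy.
  rewrite -[X in (_ <= X)%E](fineK fin_fx) lee_fin.
  by rewrite opprB addrA addrAC lerBrDr.
apply/seteqP; split=> w.
  move=> /c_subdiffP[_ xw le_f]; split=> // x fx.
  have /coupling_leP/(_ fx)[? le_fx] := le_f x.
  by split=> //=; rewrite -leE.
move=> [xw le_f]; apply/c_subdiffP; split=> // x.
by apply/coupling_leP => fx; have [? ?] := le_f x fx; rewrite leE.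
Qed.

Lemma c'_subdiff_e_convex (g : W X -> \bar R) w0 :
  (forall w, g w <> -oo%E) -> @e_convex R (weak X) (c'_subdiff g w0).
Proof.
move=> gNy; have [g0|g0] := boolP (g w0 \is a fin_num); last first.
  suff -> : c'_subdiff g w0 = set0 by exact: e_convex0.
  by rewrite -subset0 => x [fin_g0]; rewrite fin_g0 in g0.
have lt_conv (xs : dual X) (r : R) : @e_convex R (weak X) [set x | xs x < r].
  apply: (@e_convex_lt _ (weak X) xs); first exact: (dual_linear xs).
  exact: weak_dual_continuous.
have le_conv (xs : dual X) (r : R) : @e_convex R (weak X) [set x | xs x <= r].
  apply: (@e_convex_le _ (weak X) xs); first exact: (dual_linear xs).
  exact: weak_dual_continuous.
(* The roles are exchanged: [w] indexes the constraints, each a half-space of [X] given by a dual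
   element, here [w.1.2] or [w.1.1 - w0.1.1]. *)
suff -> : c'_subdiff g w0 = [set x : weak X | w0.1.2 x < w0.2] `&`
    \bigcap_(w in edom g) ([set x : weak X | w.1.2 x < w.2] `&`
      [set x : weak X | (w.1.1 - w0.1.1) x <= fine (g w) - fine (g w0)]).
  apply: e_convexI => //; apply: e_convex_bigcap => w _.
  exact: e_convexI.
have leE x w : edom g w ->
    ((w.1.1 x - (w0.1.1 x - fine (g w0)))%:E <= g w)%E =
    ((w.1.1 - w0.1.1) x <= fine (g w) - fine (g w0)).
  move=> gw; have fin_gw : g w \is a fin_num.
    by rewrite fin_numE -ltey; apply/andP; split=> //; apply/eqP/gNy.
  rewrite -[X in (_ <= X)%E](fineK fin_gw) lee_fin.
  by rewrite opprB addrA addrAC lerBrDr.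
apply/seteqP; split=> x.
  move=> /c'_subdiffP[_ xw le_g]; split=> // w gw.
  have /coupling_leP/(_ gw)[? le_gw] := le_g w.
  by split=> //=; rewrite -leE.
move=> [xw le_g]; apply/c'_subdiffP; split=> // w.
by apply/coupling_leP => gw; have [? ?] := le_g w gw; rewrite leE.
Qed.

(** * Exact minorants and the hulls *)

Lemma coupling_exact x w (r : \bar R) : r \is a fin_num -> w.1.2 x < w.2 ->
  (coupling x w - (w.1.1 x - fine r)%:E = r)%E.
Proof.
by move=> fin_r xw; rewrite /coupling xw -EFinB subKr fineK.
Qed.

Lemma e_conv_exact (f : X -> \bar R) x0 : c_subdiff f x0 !=set0 ->
  @e_conv R (weak X) f x0 = f x0.
Proof.
move=> [w /c_subdiffP[f0 xw le_f]].
(* For the remaining inequality, [f x0] is rewritten as the value at [x0] of the exact minorant,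
   which lies below the hull. *)
apply/eqP; rewrite eq_le e_conv_le/= -{1}(coupling_exact f0 xw).
exact: (e_conv_max (@coupling_epigraph_e_convex w _) le_f).
Qed.

(** Equal values at [x0] give both sides the same minorants [coupling ^~ w - b], and such a minorant
    lies below [f] exactly when it lies below the hull. *)
Lemma c_subdiff_e_conv (f : X -> \bar R) x0 : c_subdiff f x0 !=set0 ->
  @c_subdiff R X (@e_conv R (weak X) f) x0 = c_subdiff f x0.
Proof.
move=> /e_conv_exact f0E; apply/seteqP; split=> w /c_subdiffP.
  rewrite f0E => -[f0 xw le_f]; apply/c_subdiffP; split=> // x.
  exact: le_trans (le_f x) (e_conv_le _ _).
move=> [f0 xw le_f]; apply/c_subdiffP; rewrite f0E; split=> // x.
exact: (e_conv_max (@coupling_epigraph_e_convex w _) le_f).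
Qed.

Lemma coupling'_e'_convex x (a : R) :
  e'_convex_fun (fun w : W X => coupling' w x - a%:E)%E.
Proof.
by exists [set (x, a)]; apply/funext => w; rewrite image_set1 ereal_sup1.
Qed.

Lemma e'_conv_exact (g : W X -> \bar R) w0 : c'_subdiff g w0 !=set0 ->
  e'_conv g w0 = g w0.
Proof.
move=> [x /c'_subdiffP[g0 xw le_g]].
apply/eqP; rewrite eq_le e'_conv_le/= -{1}(coupling_exact g0 xw).
exact: (e'_conv_max (@coupling'_e'_convex x _) le_g).
Qed.

Lemma c'_subdiff_e'_conv (g : W X -> \bar R) w0 : c'_subdiff g w0 !=set0 ->
  c'_subdiff (e'_conv g) w0 = c'_subdiff g w0.
Proof.
move=> /e'_conv_exact g0E; apply/seteqP; split=> x /c'_subdiffP.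
  rewrite g0E => -[g0 xw le_g]; apply/c'_subdiffP; split=> // w.
  exact: le_trans (le_g w) (e'_conv_le _ _).
move=> [g0 xw le_g]; apply/c'_subdiffP; rewrite g0E; split=> // w.
exact: (e'_conv_max (@coupling'_e'_convex x _) le_g).
Qed.

(** * From the coupling to the Fenchel subdifferential *)

Lemma c'_subdiff_subdiff (g : W X -> \bar R) w0 x :
  c'_subdiff g w0 x -> subdiff g w0 (x, 0, 0).
Proof.
move=> /c'_subdiffP[g0 xw le_g]; split=> // w.
have [gw|] := ltP (g w) +oo%E; last first.
  by rewrite leye_eq => /eqP->; rewrite leey.
(* Since [g w < +oo], the coupling is the linear value [w.1.1 x]; it depends on the first component
   only, whence the two zeros in [(x, 0, 0)]. *)
have /coupling_leP/(_ gw)[_] := le_g w.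
apply: le_trans.
have formE : (w.1.1 - w0.1.1) x + (w.1.2 - w0.1.2) 0 + 0 * (w.2 - w0.2) =
    w.1.1 x - w0.1.1 x by rewrite linear0 mul0r !addr0.
rewrite -[X in (X + _)%E](fineK g0) -EFinD lee_fin [X in _ + X]formE.
by rewrite opprB addrCA.
Qed.

End Subdifferentials.

Theorem theorem3p6 (R : realType) (X : tvsType R)
  (X_hausdorff : hausdorff_space X) (X_nontrivial : exists x : X, x != 0)
  (f : X -> \bar R) (g : W X -> \bar R)
  (f_proper : eproper f) (g_proper : eproper g)
  (x0 : X) (xs0 us0 : dual X) (alpha0 : R) :
  let w0 : W X := (xs0, us0, alpha0) in
  let ecf : X -> \bar R := @e_conv R (weak X) f in
  [/\ e_convex (c_subdiff f x0) /\
      @e_convex R (weak X) (c'_subdiff g w0),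
      c_subdiff f x0 !=set0 ->
      ecf x0 = f x0 /\
      c_subdiff ecf x0 = c_subdiff f x0,
      c'_subdiff g w0 !=set0 ->
      e'_conv g w0 = g w0 /\
      c'_subdiff (e'_conv g) w0 = c'_subdiff g w0 &
      c'_subdiff g w0 x0 ->
      edom g `<=` [set w : W X | w.1.2 x0 - w.2 < 0] ->
      subdiff g w0 (x0, 0, 0)].
Proof.
move=> w0 ecf; split.
- split; first exact: c_subdiff_e_convex f_proper.1.
  exact: c'_subdiff_e_convex g_proper.1.
- by move=> df; split; [exact: e_conv_exact|exact: c_subdiff_e_conv].
- by move=> dg; split; [exact: e'_conv_exact|exact: c'_subdiff_e'_conv].
- by move=> dg _; exact: c'_subdiff_subdiff.
Qed.
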